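(* Let $f\colon\{-1,1\}^n\to\{-1,1\}$ be a Boolean function and let $\delta>0$. Then: (i) for every $\varepsilon$ with $0\le\varepsilon<1$, $\ \mathbb{H}_{1+\delta}(\hat f^2)\le 2\left(1+\frac1\delta\right)\cdot\log_2\!\left(\|\hat f\|_{1,\varepsilon}/(1-\varepsilon)\right)$; (ii) $\mathbb{H}_{1+\delta}(\hat f^2)\le 2\left(1+\frac1\delta\right)\cdot \mathsf{C}^{\oplus}_{\min}(f)$; (iii) $\mathbb{H}_{1+\delta}(\hat f^2)\le 2(1+\log_2 3)\left(1+\frac1\delta\right)\cdot R_2^{\oplus}(f)$.
   Context: All logarithms are base 2. For $g\colon\{-1,1\}^n\to\mathbb{R}$ and $S\subseteq[n]$, $\hat g(S)=\mathbb{E}_x[g(x)\prod_{i\in S}x_i]$ with $x$ uniform in $\{-1,1\}^n$. For $\alpha\ge0$, $\alpha\ne1$, the R\'enyi Fourier entropy of Boolean $f$ of order $\alpha$ is $\mathbb{H}_\alpha(\hat f^2)=\frac{1}{1-\alpha}\log\left(\sum_{S\subseteq[n]}|\hat f(S)|^{2\alpha}\right)$. Approximate spectral norm: $\|\hat f\|_{1,\varepsilon}=\min\{\sum_S|\hat p(S)| : p\colon\{-1,1\}^n\to\mathbb{R},\ |p(x)-f(x)|\le\varepsilon\ \text{for every }x\in\{-1,1\}^n\}$. Minimum parity-certificate complexity: an affine subspace of $\{-1,1\}^n$ of co-dimension $k$ is a set $\{x:\prod_{i\in S_j}x_i=b_j,\ j=1,\dots,k\}$ with $b_j\in\{-1,1\}$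 and $S_1,\dots,S_k\subseteq[n]$ having $\mathbb{F}_2$-linearly independent indicator vectors. $\mathsf{C}^\oplus_{\min}(f)$ is the minimum co-dimension of an affine subspace of $\{-1,1\}^n$ on which $f$ is constant. Randomized parity-decision tree complexity: a deterministic parity-decision tree is a rooted binary tree whose internal nodes are labelled by subsets $S\subseteq[n]$ and whose leaves are labelled by values in $\{-1,1\}$; on input $x$, at a node labelled $S$ it evaluates $\prod_{i\in S}x_i$ and continues in the corresponding subtree, outputting the label of the leaf reached. A randomized parity-decision tree is a probability distribution $\mu$ over deterministic parity-decision trees, and its complexity is the largest depth of a tree with non-zero probability under $\mu$. It computes $f$ with bounded error if for every $x$, a tree drawn from $\mu$ outputs $f(x)$ on input $x$ with probability at least $2/3$. $R_2^\oplus(f)$ is the minimum complexity of a randomized parity-decision tree computing $f$ with bounded error. *)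

(* Defs.v *)
From HB Require Import structures.
From mathcomp Require Import all_boot all_order all_algebra.
From mathcomp Require Import all_classical all_reals all_analysis.
Set Implicit Arguments.
Unset Strict Implicit.
Unset Printing Implicit Defensive.
Import Order.TTheory GRing.Theory Num.Theory.
Import numFieldTopology.Exports numFieldNormedType.Exports.
Local Open Scope ring_scope.

(* {-1,1} is encoded by bool through b |-> (-1) ^+ b, i.e. false stands for 1
   and true for -1; multiplication in {-1,1} then becomes addb. *)
Definition cube (n : nat) := {ffun 'I_n -> bool}.

Definition sign (R : realType) (b : bool) : R := (-1) ^+ b.

(* The product of x_i over i in S, as an element of {-1,1}; see chiE. *)
Definition parity n (S : {set 'I_n}) (x : cube n) : bool :=
  \big[addb/false]_(i in S) x i.

Definition chi (R : realType) n (S : {set 'I_n}) (x : cube n) : R :=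
  \prod_(i in S) sign R (x i).

Lemma chiE (R : realType) n (S : {set 'I_n}) (x : cube n) :
  chi R S x = sign R (parity S x).
Proof.
by rewrite /sign /parity /chi; elim/big_rec2: _ => // i b r _ ->; rewrite signr_addb.
Qed.

Section Fourier.
Variables (R : realType) (n : nat).
Implicit Types (g p : cube n -> R) (f : cube n -> bool).

Definition fourier g (S : {set 'I_n}) : R :=
  (\sum_(x : cube n) g x * chi R S x) / #|{: cube n}|%:R.

Definition spectral_norm g : R := \sum_(S : {set 'I_n}) `|fourier g S|.

Definition log2 (x : R) : R := ln x / ln 2.

(* Caveat: 0 `^ 0 = 1, so for alpha = 0 the vanishing coefficients are counted
   too. *)
Definition renyi_fourier_entropy (alpha : R) f : R :=
  (1 - alpha)^-1 *
  log2 (\sum_(S : {set 'I_n})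
          `|fourier (fun x => sign R (f x)) S| `^ (2 * alpha)).

Definition approximates (eps : R) f p : Prop :=
  forall x, `|p x - sign R (f x)| <= eps.

(* For 0 <= eps the infimum is a minimum: see approx_spectral_norm_min. *)
Definition approx_spectral_norm (eps : R) f : R :=
  inf [set spectral_norm p | p in approximates eps f]%classic.

Lemma approx_spectral_norm_min (eps : R) f : 0 <= eps ->
  exists p, [/\ approximates eps f p,
    approx_spectral_norm eps f = spectral_norm p &
    forall q, approximates eps f q -> spectral_norm p <= spectral_norm q].
Proof.
move=> eps0.
pose fn (v : 'rV[R]_#|{: cube n}|) (x : cube n) := v ord0 (enum_rank x).
pose I (i : 'I_#|{: cube n}|) : set R :=
  `[sign R (f (enum_val i)) - eps, sign R (f (enum_val i)) + eps]%classic.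
pose A := [set v : 'rV[R]_#|{: cube n}| | forall i, I i (v ord0 i)]%classic.
have cA : compact A by apply: rV_compact => i; exact: segment_compact.
have AE v : A v <-> approximates eps f (fn v).
  split=> [Av x|Av i].
    by have := Av (enum_rank x); rewrite /I/= in_itv/= enum_rankK -ler_distl.
  by have := Av (enum_val i); rewrite /I/= in_itv/= -ler_distl /fn enum_valK.
have A0 : (A !=set0)%classic.
  exists (\row_i sign R (f (enum_val i))); apply/AE => x.
  by rewrite /fn mxE enum_rankK subrr normr0.
have sumC (J : finType) (F : J -> 'rV[R]_#|{: cube n}| -> R) :
    (forall j, continuous (F j)) -> continuous (fun v => \sum_j F j v).
  move=> cF; apply: (@continuous_big R J +%R 0 xpredT) => [|j _]; last exact: cF.
  by move=> z; apply: cvgD; [exact: cvg_fst|exact: cvg_snd].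
have cF S : continuous (fun v => fourier (fn v) S).
  move=> v; apply: (@cvgMr_tmp _ _ (nbhs v)); move: v.
  apply: (sumC _ (fun x v => fn v x * chi R S x)) => x v.
  by apply: (@cvgMr_tmp _ _ (nbhs v)); exact: coord_continuous.
have cf : continuous (fun v => spectral_norm (fn v)).
  apply: (sumC _ (fun S v => `|fourier (fn v) S|)) => S v.
  by apply: (@cvg_norm _ _ _ (nbhs v)); exact: cF.
have [c cin cmin] := compact_EVT_min A0 cA (continuous_subspaceT cf).
rewrite inE in cin.
have minP q : approximates eps f q -> spectral_norm (fn c) <= spectral_norm q.
  move=> hq; have qE : q = fn (\row_i q (enum_val i)).
    by apply/funext => x; rewrite /fn mxE enum_rankK.
  by rewrite qE; apply: cmin; rewrite inE; apply/AE; rewrite -qE.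
exists (fn c); split => //; first exact/AE.
apply/eqP; rewrite eq_le; apply/andP; split.
  apply: ge_inf; last by exists (fn c) => //; apply/AE.
  by exists 0 => _ [q _ <-]; apply: sumr_ge0.
apply: lb_le_inf; first by exists (spectral_norm (fn c)), (fn c) => //; apply/AE.
by move=> _ [q hq <-]; exact: minP.
Qed.

End Fourier.

Section ParityCertificate.
Variable n : nat.

Definition indicator_mx k (S : {ffun 'I_k -> {set 'I_n}}) : 'M['F_2]_(k, n) :=
  \matrix_(j < k, i < n) (i \in S j)%:R.

Definition affine_subspace_codim (k : nat) (A : {set cube n}) : bool :=
  [exists S : {ffun 'I_k -> {set 'I_n}}, [exists b : {ffun 'I_k -> bool},
    row_free (indicator_mx S) &&
    (A == [set x | [forall j, parity (S j) x == b j]])]].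

Definition constant_on (f : cube n -> bool) (A : {set cube n}) : bool :=
  [forall x in A, forall y in A, f x == f y].

Definition has_parity_certificate f (k : nat) : bool :=
  [exists A : {set cube n}, affine_subspace_codim k A && constant_on f A].

Lemma has_parity_certificate_ex f : exists k, has_parity_certificate f k.
Proof.
exists n; apply/existsP.
exists [set x | [forall j, parity [set j] x == false]]; apply/andP; split.
  apply/existsP; exists [ffun j => [set j]].
  apply/existsP; exists [ffun=> false]; apply/andP; split.
    suff -> : indicator_mx [ffun j => [set j]] = 1%:M.
      by rewrite row_free_unit unitmx1.
    by apply/matrixP => j i; rewrite !mxE ffunE inE eq_sym.
  by apply/eqP/setP => x; rewrite !inE; apply: eq_forallb => j; rewrite !ffunE.
apply/forall_inP => x; rewrite inE => /forallP hx.
apply/forall_inP => y; rewrite inE => /forallP hy.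
suff -> : x = y by [].
apply/ffunP => i; move/eqP: (hx i); move/eqP: (hy i).
by rewrite /parity !big_set1 => -> ->.
Qed.

Definition min_parity_certificate f : nat :=
  ex_minn (has_parity_certificate_ex f).

End ParityCertificate.

(* In Node A t0 t1 the computation goes on with t0 if the product of the x_i
   over A is 1 and with t1 if it is -1. *)
Inductive pdt (n : nat) : Type :=
  | Leaf of bool
  | Node of {set 'I_n} & pdt n & pdt n.
Arguments Leaf {n}.

Section ParityDecisionTrees.
Variable n : nat.

Fixpoint pdt_eval (t : pdt n) (x : cube n) : bool :=
  match t with
  | Leaf b => b
  | Node A t0 t1 => if parity A x then pdt_eval t1 x else pdt_eval t0 x
  end.

Fixpoint pdt_depth (t : pdt n) : nat :=
  match t with
  | Leaf _ => 0
  | Node _ t0 t1 => (maxn (pdt_depth t0) (pdt_depth t1)).+1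
  end.

Fixpoint pdt_encode (t : pdt n) : GenTree.tree (bool + {set 'I_n}) :=
  match t with
  | Leaf b => GenTree.Leaf (inl b)
  | Node A t0 t1 =>
      GenTree.Node 0 [:: GenTree.Leaf (inr A); pdt_encode t0; pdt_encode t1]
  end.

Fixpoint pdt_decode (t : GenTree.tree (bool + {set 'I_n})) : option (pdt n) :=
  match t with
  | GenTree.Leaf (inl b) => Some (Leaf b)
  | GenTree.Node _ [:: GenTree.Leaf (inr A); u0; u1] =>
      if pdt_decode u0 is Some t0 then
        if pdt_decode u1 is Some t1 then Some (Node A t0 t1) else None
      else None
  | _ => None
  end.

Lemma pdt_encodeK : pcancel pdt_encode pdt_decode.
Proof. by elim=> //= A t0 -> t1 ->. Qed.

HB.instance Definition _ := Countable.copy (pdt n) (pcan_type pdt_encodeK).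
HB.instance Definition _ := isPointed.Build (pdt n) (Leaf false).
HB.instance Definition _ := @isMeasurable.Build default_measure_display
  (pdt n) discrete_measurable discrete_measurable0
  discrete_measurableC discrete_measurableU.

End ParityDecisionTrees.

(* A randomized parity-decision tree is a probability measure on the countable
   type pdt n equipped with its discrete sigma-algebra. *)
Section RandomizedParityDecisionTrees.
Variables (R : realType) (n : nat).
Implicit Types (mu : probability (pdt n) R) (f : cube n -> bool).

Definition rpdt_complexity mu (c : nat) : Prop :=
  (exists2 t, mu [set t]%classic != 0%E & pdt_depth t = c) /\
  (forall t, mu [set t]%classic != 0%E -> (pdt_depth t <= c)%N).

Definition rpdt_computes mu f : Prop :=
  forall x, ((2 / 3)%:E <= mu [set t | pdt_eval t x = f x]%classic)%E.

Definition has_rpdt f : pred nat := fun c =>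
  `[< exists2 mu, rpdt_complexity mu c & rpdt_computes mu f >].

Lemma pdt_computing f : exists t, forall x, pdt_eval t x = f x.
Proof.
pose upd (x : cube n) (i : 'I_n) b : cube n := [ffun k => if k == i then b else x k].
suff H (s : seq 'I_n) g :
    (forall x y : cube n, {in s, forall i, x i = y i} -> g x = g y) ->
    exists t : pdt n, forall x, pdt_eval t x = g x.
  apply: (H (enum 'I_n)) => x y xy; congr f; apply/ffunP => i.
  by apply: xy; rewrite mem_enum.
elim: s g => [|i s IHs] g dep.
  by exists (Leaf (g [ffun=> false])) => x /=; apply: dep.
have depU b (x y : cube n) : {in s, forall j, x j = y j} -> g (upd x i b) = g (upd y i b).
  move=> xy; apply: dep => j; rewrite inE !ffunE.
  by case: eqP => //= _ /xy.
have updE (x : cube n) : upd x i (x i) = x.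
  by apply/ffunP => k; rewrite ffunE; case: eqP => // ->.
have [t0 t0E] := IHs (fun x => g (upd x i false)) (depU false).
have [t1 t1E] := IHs (fun x => g (upd x i true)) (depU true).
exists (Node [set i] t0 t1) => x /=.
rewrite /parity big_set1 -[in RHS](updE x).
by case: (x i); rewrite ?t0E ?t1E.
Qed.

Lemma has_rpdt_ex f : exists c, has_rpdt f c.
Proof.
have [t tE] := pdt_computing f; exists (pdt_depth t); apply/asboolP.
exists (dirac t : probability (pdt n) R).
  have dE t' : (\d_t [set t']%classic != 0 :> \bar R)%E -> t' = t.
    rewrite /= diracE; case: (boolP (t \in _)); last by rewrite eqxx.
    by rewrite inE.
  split; last by move=> t' /dE ->.
  by exists t => //=; rewrite diracE mem_set//= onee_neq0.
move=> x; rewrite /= diracE mem_set//= ?tE// lee_fin.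
by rewrite ler_pdivrMr// mul1r ler_nat.
Qed.

Definition randomized_parity_complexity f : nat := ex_minn (has_rpdt_ex f).

End RandomizedParityDecisionTrees.

(* Main.v *)
Require Import Defs.
From mathcomp Require Import all_boot all_order all_algebra.
From mathcomp Require Import all_classical all_reals all_analysis.
From mathcomp Require Import ring lra.
Import Order.TTheory GRing.Theory Num.Theory.
Local Open Scope ring_scope.

(* Let m be the largest |f^(S)|. Keeping only this coefficient in the Renyi sum
   gives H_{1+delta} <= 2 (1 + 1/delta) log (1/m), so each part reduces to a
   lower bound on m, obtained by correlating f with a function h:
   (i)   h = p an approximation of f: 1 - eps <= E[f p] <= m * sum_S |p^(S)|;
   (ii)  h = 2^k times the indicator of an affine subspace of codimension k on
         which f is constant: |E[f h]| = 1, and h is a signed sum of 2^k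
         characters;
   (iii) h = a tree of depth at most c agreeing with f on 2/3 of the inputs,
         which exists by averaging over the distribution: 1/3 <= E[f h] and
         |E[f h]| <= 2^c m by induction on the tree. When c = 0 this is too weak
         (the claim is then H <= 0), but in that case f is constant. *)

(** * Fourier analysis on the cube *)

Section FourierFacts.
Context {R : realType} {n : nat}.
Implicit Types (g h : cube n -> R) (S T : {set 'I_n}) (x y : cube n).

Lemma sqr_sign (b : bool) : sign R b * sign R b = 1.
Proof. by rewrite -expr2 sqrr_sign. Qed.

Lemma norm_sign (b : bool) : `|sign R b| = 1.
Proof. exact: normr_sign. Qed.

Lemma card_cube : #|{: cube n}| = (2 ^ n)%N.
Proof. by rewrite card_ffun card_bool card_ord. Qed.

Lemma card_cube_gt0 : 0 < #|{: cube n}|%:R :> R.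
Proof. by rewrite card_cube ltr0n expn_gt0. Qed.

(** The sum over [S] factors as the product over [i] of [1 + x_i * y_i], and a coordinate where [x]
    and [y] differ gives a factor 0. *)
Lemma sum_chi x y : \sum_S chi R S x * chi R S y = #|{: cube n}|%:R * (x == y)%:R.
Proof.
transitivity (\prod_i (sign R (x i) * sign R (y i) + 1)).
  rewrite bigA_distr; apply: eq_bigr => S _.
  by rewrite /chi -big_split /= big_mkcond.
have [<-|xy] := eqVneq x y.
  under eq_bigr do rewrite sqr_sign.
  by rewrite prodr_const card_ord card_cube mulr1 natrX.
have [i xyi] : exists i, x i != y i.
  by apply/existsP; apply: contraNT xy; rewrite negb_exists => /forallP xy;
     apply/eqP/ffunP => i; apply/eqP; move: (xy i); rewrite negbK.
rewrite (bigD1 i) //= mulr0 /sign -signr_addb.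
by rewrite (_ : x i (+) y i = true) ?addNr ?mul0r //; case: (x i) (y i) xyi => [] [].
Qed.

Lemma fourier_inversion g x : g x = \sum_S fourier g S * chi R S x.
Proof.
rewrite /fourier; under eq_bigr do rewrite mulrAC mulr_suml.
rewrite -mulr_suml exchange_big /=.
under eq_bigr => y _ do under eq_bigr do rewrite -mulrA.
under eq_bigr do rewrite -mulr_sumr sum_chi.
rewrite (bigD1 x) //= eqxx big1 ?addr0 => [|y /negPf ->]; last by rewrite !mulr0.
by rewrite mulr1 mulfK // gt_eqF // card_cube_gt0.
Qed.

Lemma fourier_plancherel g h :
  (\sum_x g x * h x) / #|{: cube n}|%:R = \sum_S fourier g S * fourier h S.
Proof.
under eq_bigr do rewrite [g _]fourier_inversion mulr_suml.
rewrite exchange_big /= mulr_suml; apply: eq_bigr => S _.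
under eq_bigr do rewrite -mulrA [chi _ _ _ * _]mulrC.
by rewrite -mulr_sumr -mulrA.
Qed.

Lemma chi_set0 x : chi R finset.set0 x = 1.
Proof. by rewrite /chi big_set0. Qed.

Lemma fourier_set0 g : fourier g finset.set0 = (\sum_x g x) / #|{: cube n}|%:R.
Proof. by rewrite /fourier; under eq_bigr do rewrite chi_set0 mulr1. Qed.

(** The sum over the cube factors into coordinates; each [i] in [S] contributes [1 + (-1) = 0]. *)
Lemma fourier_cst (c : R) S : fourier (fun=> c) S = c * (S == finset.set0)%:R.
Proof.
rewrite /fourier -mulr_sumr -mulrA; congr (_ * _).
transitivity ((\prod_i \sum_(b : bool) (if i \in S then sign R b else 1)) / #|{: cube n}|%:R).
  congr (_ / _); rewrite bigA_distr_bigA; apply: eq_bigr => x _.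
  by rewrite /chi big_mkcond.
have [->|/finset.set0Pn[i iS]] := eqVneq S finset.set0.
  under eq_bigr do rewrite big_bool inE.
  by rewrite prodr_const card_ord card_cube natrX divff //; apply: expf_neq0; rewrite (pnatr_eq0 R 2).
by rewrite (bigD1 i) //= big_bool iS /sign /= expr1 expr0 addNr !mul0r.
Qed.

Lemma parityE S x : parity S x = \big[addb/false]_i ((i \in S) && x i).
Proof. by rewrite /parity big_mkcond; apply: eq_bigr => i _; case: ifP. Qed.

(** The symmetric difference of the [S j] for [j] in [T], that is, the sum over ['F_2] of the
    corresponding rows of [indicator_mx S]. *)
Definition symdiff_family {k} (S : {ffun 'I_k -> {set 'I_n}}) (T : {set 'I_k}) : {set 'I_n} :=
  [set i | \big[addb/false]_(j in T) (i \in S j)].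

Lemma chi_symdiff_family k (S : {ffun 'I_k -> {set 'I_n}}) (T : {set 'I_k}) x :
  chi R (symdiff_family S T) x = \prod_(j in T) chi R (S j) x.
Proof.
under eq_bigr do rewrite chiE.
rewrite -(big_morph (sign R) (@signr_addb R) (expr0 _ : sign R false = 1)) chiE.
congr sign; under [in RHS]eq_bigr do rewrite parityE.
rewrite exchange_big parityE; apply: eq_bigr => i _.
by rewrite inE big_distrl.
Qed.

(** The indicator of [symdiff_family S T] is the indicator row [u] of [T] times [indicator_mx S],
    and multiplication by a row-free matrix is injective. *)
Lemma symdiff_family_eq0 k (S : {ffun 'I_k -> {set 'I_n}}) (T : {set 'I_k}) :
  row_free (indicator_mx S) -> (symdiff_family S T == finset.set0) = (T == finset.set0).
Proof.
move=> /row_free_inj freeS; apply/eqP/eqP => [ST0|->]; last first.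
  by apply/setP => i; rewrite !inE big_set0.
have natr_addb (a b : bool) : (a (+) b)%:R = a%:R + b%:R :> 'F_2.
  by apply/eqP; case: a b => [] [].
pose u : 'rV['F_2]_k := \row_j (j \in T)%:R.
suff u0 : u = 0.
  apply/setP => j; have := congr1 (fun v : 'rV['F_2]_k => v ord0 j) u0.
  by rewrite !mxE inE; case: (j \in T).
apply: freeS; rewrite mul0mx; apply/rowP => i; rewrite !mxE.
under eq_bigr do rewrite !mxE -natrM mulnb.
have /setP/(_ i) := ST0; rewrite !inE => STi.
have natr_false : false%:R = 0 :> 'F_2 by [].
rewrite -(big_morph (fun b : bool => b%:R : 'F_2) natr_addb natr_false).
rewrite (_ : \big[_/_]_j _ = false) // -[RHS]STi [in RHS]big_mkcond.
by apply: eq_bigr => j _; case: (j \in T).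
Qed.

Lemma chiM S T x :
  chi R S x * chi R T x = chi R ((S :\: T) :|: (T :\: S)) x.
Proof.
rewrite !chiE /sign -signr_addb; congr (_ ^+ nat_of_bool _).
rewrite !parityE -big_split; apply: eq_bigr => i _ /=.
by rewrite !inE; case: (i \in S) (i \in T) (x i) => [] [] [].
Qed.

Lemma exists_max_fourier g : exists S, forall T, `|fourier g T| <= `|fourier g S|.
Proof.
have [S _ maxS] := @arg_maxP _ _ {set 'I_n} finset.set0 predT (fun S => `|fourier g S|) isT.
by exists S => T; exact: maxS.
Qed.

(* The value of [Node A t0 t1] is [(t0 + t1) / 2 + chi A * (t0 - t1) / 2]. *)
Lemma fourier_pdt_le g (m : R) (t : pdt n) S :
  (forall T, `|fourier g T| <= m) ->
  `|fourier (fun x => g x * sign R (pdt_eval t x)) S| <= 2 ^+ pdt_depth t * m.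
Proof.
move=> gm; have m0 : 0 <= m by apply: le_trans (gm finset.set0).
elim: t S => [b|A t0 IH0 t1 IH1] S /=.
  rewrite mul1r (_ : fourier _ _ = fourier g S * sign R b).
    by rewrite normrM norm_sign mulr1.
  rewrite /fourier [RHS]mulrAC [in RHS]mulr_suml; congr (_ / _).
  by apply: eq_bigr => x _; rewrite mulrAC.
set d := maxn _ _; pose SA := (S :\: A) :|: (A :\: S).
pose F t := fourier (fun x => g x * sign R (pdt_eval t x)).
(* Multiplication by [chi A] moves the coefficient at [SA] to [S]. *)
have FE : fourier (fun x => g x * sign R (if parity A x then pdt_eval t1 x else pdt_eval t0 x)) S
    = 2^-1 * (F t0 S + F t0 SA + (F t1 S - F t1 SA)).
  rewrite /F /fourier -mulrDl -mulrBl -mulrDl mulrA; congr (_ / _).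
  rewrite -big_split -sumrB -big_split mulr_sumr; apply: eq_bigr => x _ /=.
  rewrite -!chiM [chi R A x]chiE /sign.
  by case: (parity A x); rewrite ?expr1 ?expr0; field.
have le_d t : (forall T, `|F t T| <= 2 ^+ pdt_depth t * m) ->
    (pdt_depth t <= d)%N -> forall T, `|F t T| <= 2 ^+ d * m.
  move=> Ft td T; apply: le_trans (Ft T) _; apply: ler_wpM2r => //.
  by rewrite ler_eXn2l // ltr1n.
have d0 := le_d t0 IH0 (leq_maxl _ _); have d1 := le_d t1 IH1 (leq_maxr _ _).
(* Four terms of size at most [2 ^+ d * m], halved, give the one extra factor 2 of this level. *)
rewrite FE exprS.
have := d0 S; have := d0 SA; have := d1 S; have := d1 SA.
rewrite !ler_norml => /andP[? ?] /andP[? ?] /andP[? ?] /andP[? ?].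
by apply/andP; split; lra.
Qed.

End FourierFacts.

(** * Entropy bounded through a single coefficient *)

Section Entropy.
Context {R : realType} {n : nat}.
Implicit Types (f : cube n -> bool) (S : {set 'I_n}).

Lemma ln2_gt0 : 0 < ln 2 :> R.
Proof. by rewrite ln_gt0 // ltr1n. Qed.

Lemma ler_log2 (x y : R) : 0 < x -> x <= y -> log2 x <= log2 y.
Proof.
move=> x0 xy; rewrite /log2 ler_pM2r ?invr_gt0 ?ln2_gt0 // ler_ln // posrE //.
exact: lt_le_trans xy.
Qed.

(** The prefactor of the logarithm is [- 1 / delta], so a lower bound on the sum bounds the entropy
    from above; the constant is [2 * (1 + delta) / delta]. *)
Lemma renyi_fourier_entropy_le f (delta m : R) S : 0 < delta -> 0 < m ->
  m <= `|fourier (fun x => sign R (f x)) S| ->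
  renyi_fourier_entropy (1 + delta) f <= 2 * (1 + 1 / delta) * log2 m^-1.
Proof.
move=> d0 m0 mS; rewrite /renyi_fourier_entropy.
set s := \sum_S _.
have ms : m `^ (2 * (1 + delta)) <= s.
  rewrite /s (bigD1 S) //= -[leLHS]addr0 lerD ?sumr_ge0 // => *; rewrite ?powR_ge0 //.
  by apply: ge0_ler_powR; rewrite ?nnegrE //; lra.
have := ler_log2 _ _ (powR_gt0 _ m0) ms.
rewrite /log2 ln_powR lnV ?posrE // => le_s.
rewrite opprD addrA subrr sub0r invrN mulNr -mulrN mulrC ler_pdivrMr //.
rewrite -lerN2 opprK; apply: le_trans le_s.
by rewrite le_eqVlt; apply/orP; left; apply/eqP; field; rewrite !gt_eqF ?ln2_gt0.
Qed.

End Entropy.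

(** * Averaging over a distribution on trees *)

Section RandomizedTrees.
Context {R : realType} {n : nat}.
Implicit Types (mu : probability (pdt n) R) (f : cube n -> bool).

(** Since [pdt n] is countable, [A] is covered by countably many sets [F k], each empty or a null
    singleton. *)
Lemma rpdt_null mu (A : set (pdt n)) :
  (forall t, A t -> mu [set t]%classic = 0%E) -> mu A = 0%E.
Proof.
move=> A0; apply: measure_negligible => //.
pose F k : set (pdt n) := [set t | A t /\ unpickle k = Some t]%classic.
have AF : (A `<=` \bigcup_k F k)%classic.
  by move=> t At; exists (pickle t) => //; split; rewrite ?pickleK.
apply: negligibleS AF _; apply: negligible_bigcup => k.
case E : (unpickle k : option (pdt n)) => [t|]; last first.
  apply: negligibleS (negligible_set0 _).
  by move=> t []; rewrite E.
have [At|nAt] := pselect (A t).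
  exists [set t]%classic; split => //; first exact: A0.
  by move=> s [_]; rewrite E => -[->].
apply: negligibleS (negligible_set0 _).
by move=> s [As]; rewrite E => -[ts]; apply: nAt; rewrite ts.
Qed.

Lemma rpdt_support mu (A : set (pdt n)) :
  mu A != 0%E -> exists2 t, A t & mu [set t]%classic != 0%E.
Proof.
move=> muA; apply: contrapT => noA; move/eqP: muA; apply.
apply: rpdt_null => t At; apply: contrapT => /eqP mut.
by apply: noA; exists t.
Qed.

(** The expected number of correctly answered inputs is at least 2/3 of the cube, so some tree of
    nonzero mass reaches this average. *)
Lemma rpdt_agreement mu f : rpdt_computes mu f ->
  exists2 t, mu [set t]%classic != 0%E &
    (2 * #|{: cube n}| <= 3 * #|[set x | pdt_eval t x == f x]|)%N.
Proof.
move=> muf; apply: contrapT => bad.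
pose N : R := #|{: cube n}|%:R.
pose A x : set (pdt n) := [set t | pdt_eval t x = f x]%classic.
pose count (t : pdt n) : R := \sum_x \1_(A x) t.
have countE t : count t = #|[set x | pdt_eval t x == f x]%SET|%:R.
  rewrite /count -sum1_card natr_sum [RHS]big_mkcond; apply: eq_bigr => x _.
  rewrite inE indicE; case: eqP => [?|ne]; first by rewrite mem_set.
  by rewrite memNset.
have lower : ((N * (2 / 3))%:E <= \int[mu]_t (count t)%:E)%E.
  rewrite (eq_integral (fun t => \sum_x (\1_(A x) t)%:E)%E); last first.
    by move=> t _; rewrite /count sumEFin.
  rewrite ge0_integral_sum //.
  under eq_bigr do rewrite integral_indic // setIT.
  apply: le_trans (lee_sum _ (fun x _ => muf x)).
  by rewrite sumEFin lee_fin sumr_const /N mulr_natl.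
(* A failing tree has [3 * count t < 2 * N]; by integrality [3 * count t <= 2 * N - 1], and this gap
   makes an almost-everywhere bound contradict [lower]. *)
have upper : (\int[mu]_t (count t)%:E <= ((2 * N - 1) / 3)%:E)%E.
  have -> : (((2 * N - 1) / 3)%:E = \int[mu]_t (cst ((2 * N - 1) / 3)%:E t))%E.
    rewrite integral_cst // -[LHS]mule1; congr (_ * _)%E.
    by apply/esym; exact: (@probability_setT _ _ _ mu).
  have N1 : 1 <= N by rewrite ler1n -(ltr0n R) card_cube_gt0.
  apply: (@ae_ge0_le_integral _ _ _ mu setT measurableT (fun t => (count t)%:E)
    (cst ((2 * N - 1) / 3)%:E)) => //.
  - by move=> t _; rewrite lee_fin countE.
  - by move=> t _; rewrite lee_fin; lra.
  exists [set t | mu [set t]%classic = 0%E]%classic; split => //; first exact: rpdt_null.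
  move=> t /= nt; apply: contrapT => mut; apply: nt => _.
  rewrite lee_fin countE ler_pdivlMr // mulrC lerBrDr -natrM natr1 -natrM ler_nat.
  by rewrite ltnNge; apply/negP => ok; apply: bad; exists t => //; apply/eqP.
have := le_trans lower upper; rewrite lee_fin; lra.
Qed.

End RandomizedTrees.

(** * Lower bounds on the largest coefficient *)

Section Bounds.
Context {R : realType} {n : nat} (f : cube n -> bool).
Local Notation F := (fun x => sign R (f x)).

Lemma approx_spectral_norm_ge (eps m : R) : 0 <= eps ->
  (forall S, `|fourier F S| <= m) -> 1 - eps <= m * approx_spectral_norm eps f.
Proof.
move=> eps0 Fm; have [p [pf -> _]] := approx_spectral_norm_min f eps0.
(* Pointwise [p x * F x >= 1 - eps], because [F x] is a sign; Plancherel turns the average into this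
   sum. *)
have corr : 1 - eps <= \sum_S fourier p S * fourier F S.
  rewrite -fourier_plancherel ler_pdivlMr ?card_cube_gt0 //.
  rewrite mulr_natr -sumr_const; apply: ler_sum => x _.
  have := pf x; rewrite ler_norml /sign => /andP[]; case: (f x) => /=; lra.
apply: le_trans corr _; rewrite /spectral_norm mulr_sumr; apply: ler_sum => S _.
apply: le_trans (ler_norm _) _; rewrite normrM mulrC; exact: ler_wpM2r.
Qed.

(* On [A], the product of the [1 + b j * chi (S j)] is [2 ^ k]; off [A] it
   vanishes. *)
Lemma parity_certificate_ge (k : nat) (m : R) : has_parity_certificate f k ->
  (forall S, `|fourier F S| <= m) -> 1 <= 2 ^+ k * m.
Proof.
move=> /existsP[A /andP[/existsP[S /existsP[b /andP[freeS /eqP AE]]] fA]] Fm.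
pose w (x : cube n) : R := \prod_j (sign R (b j) * chi R (S j) x + 1).
pose B (T : {set 'I_k}) : R := \prod_(j in T) sign R (b j).
have B1 T : `|B T| = 1.
  by rewrite /B normr_prod big1 // => j _; exact: norm_sign.
(* Expand the product [w] over the subsets [T] of constraints. *)
have gw g : fourier (fun x => g x * w x) finset.set0
    = \sum_T B T * fourier g (symdiff_family S T).
  rewrite fourier_set0 /fourier; under [RHS]eq_bigr do rewrite mulrA.
  rewrite -mulr_suml; congr (_ / _).
  under [RHS]eq_bigr do rewrite mulr_sumr.
  rewrite exchange_big; apply: eq_bigr => x _ /=.
  rewrite /w bigA_distr mulr_sumr; apply: eq_bigr => T _.
  rewrite chi_symdiff_family mulrCA -big_split [in RHS]big_mkcond.
  by congr (_ * _); apply: eq_bigr => j _; case: ifP.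
have w_notin x : x \notin A -> w x = 0.
  rewrite AE inE negb_forall => /existsP[j Sj].
  rewrite /w (bigD1 j) //= chiE /sign -signr_addb.
  rewrite (_ : b j (+) _ = true) ?expr1 ?addNr ?mul0r //.
  by case: (b j) (parity _ _) Sj => [] [].
have [c cE] : exists c, forall x, F x * w x = sign R c * w x.
  have [A0|/finset.set0Pn[y yA]] := eqVneq A finset.set0.
    (* If [A] is empty then [w] vanishes everywhere, and any sign will do. *)
    by exists true => x; rewrite w_notin ?mulr0 // A0 inE.
  exists (f y) => x; have [xA|xA] := boolP (x \in A); last by rewrite w_notin ?mulr0.
  by have /forall_inP/(_ x xA)/forall_inP/(_ y yA)/eqP -> := fA.
have : `|fourier (fun x => F x * w x) finset.set0| = 1.
  under eq_fun do rewrite cE.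
  (* By independence only [T = set0] yields the trivial character, so [w] has mean 1. *)
  rewrite (gw (fun=> sign R c)) (bigD1 finset.set0) //= big1 => [|T T0].
    by rewrite fourier_cst symdiff_family_eq0 // eqxx addr0 mulr1 normrM B1 norm_sign mulr1.
  by rewrite fourier_cst symdiff_family_eq0 // (negPf T0) !mulr0.
rewrite gw => sum1; rewrite -[leLHS]sum1; apply: le_trans (ler_norm_sum _ _ _) _.
have -> : 2 ^+ k * m = \sum_(T : {set 'I_k}) m.
  by rewrite sumr_const -cardsT -powersetT card_powerset cardsT card_ord -[RHS]mulr_natl natrX.
by apply: ler_sum => T _; rewrite normrM B1 mul1r.
Qed.

(** Agreement on 2/3 of the inputs means correlation at least [2 * (2 / 3) - 1 = 1 / 3]. *)
Lemma pdt_agreement_ge (t : pdt n) (m : R) :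
  (2 * #|{: cube n}| <= 3 * #|[set x | pdt_eval t x == f x]%SET|)%N ->
  (forall S, `|fourier F S| <= m) -> 1 / 3 <= 2 ^+ pdt_depth t * m.
Proof.
move=> agree Fm; apply: le_trans (fourier_pdt_le F m t finset.set0 Fm).
apply: le_trans (ler_norm _); rewrite fourier_set0 ler_pdivlMr ?card_cube_gt0 //.
have -> : \sum_x F x * sign R (pdt_eval t x)
    = 2 * #|[set x | pdt_eval t x == f x]%SET|%:R - #|{: cube n}|%:R.
  have -> : #|{: cube n}|%:R = \sum_(x : cube n) 1 :> R by rewrite sumr_const.
  rewrite -sum1_card natr_sum [in RHS]big_mkcond mulr_sumr -sumrB.
  apply: eq_bigr => x _; rewrite inE /sign.
  by case: (f x) (pdt_eval t x) => [] [] /=; rewrite ?expr0 ?expr1; ring.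
have : (2 * #|{: cube n}|)%:R <= (3 * #|[set x | pdt_eval t x == f x]%SET|)%:R :> R.
  by rewrite ler_nat.
rewrite !natrM; lra.
Qed.

(* Two inputs each answered correctly with probability at least 2/3 are
   answered correctly by a common tree, here a leaf. *)
Lemma rpdt_complexity0_cst (mu : probability (pdt n) R) :
  rpdt_complexity mu 0 -> rpdt_computes mu f -> forall x y, f x = f y.
Proof.
move=> [_ depth0] muf x y.
pose A z : set (pdt n) := [set t | pdt_eval t z = f z]%classic.
have : mu (A x `&` A y)%classic != 0%E.
  (* Were the intersection null, the union would have mass at least 4/3. *)
  apply/eqP => muI; have := probability_le1 mu (A := (A x `|` A y)%classic) I.
  have fin := le_lt_trans (probability_le1 mu (A := A y) I) (ltry 1).
  rewrite measureUfinr // [X in (_ - X)%E]muI sube0 => le1.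
  have := le_trans (leeD (muf x) (muf y)) le1.
  rewrite -EFinD lee_fin; lra.
move=> /rpdt_support[t [tx ty] /depth0]; rewrite leqn0 => /eqP.
by case: t tx ty => [b|] //= <- <-.
Qed.

End Bounds.

Theorem corollary4p6 (R : realType) (n : nat) (f : cube n -> bool)
    (delta : R) (delta_gt0 : 0 < delta) :
  (forall eps : R, 0 <= eps < 1 ->
     renyi_fourier_entropy (1 + delta) f <=
       2 * (1 + 1 / delta) * log2 (approx_spectral_norm eps f / (1 - eps))) /\
  renyi_fourier_entropy (1 + delta) f <=
    2 * (1 + 1 / delta) * (min_parity_certificate f)%:R /\
  renyi_fourier_entropy (1 + delta) f <=
    2 * (1 + log2 (3 : R)) * (1 + 1 / delta) *
      (randomized_parity_complexity R f)%:R.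
Proof.
have [S maxS] := exists_max_fourier (fun x => sign R (f x)).
set m := `|fourier (fun x => sign R (f x)) S| in maxS.
have m0 : 0 <= m by exact: normr_ge0.
have C0 : 0 <= 2 * (1 + 1 / delta) by rewrite mulr_ge0 // addr_ge0 // divr_ge0 // ltW.
have entropy_le a : 0 < a -> 1 <= a * m ->
    renyi_fourier_entropy (1 + delta) f <= 2 * (1 + 1 / delta) * log2 a.
  move=> a0 am; rewrite -[a]invrK; apply: (renyi_fourier_entropy_le _ _ _ S); rewrite ?invr_gt0 //.
  by rewrite -div1r ler_pdivrMr // mulrC.
have log2X k : log2 (2 ^+ k : R) = k%:R.
  by rewrite /log2 lnXn // mulrnAl divff // gt_eqF // ln2_gt0.
split; [|split].
- move=> eps /andP[eps0 eps1].
  have := approx_spectral_norm_ge f eps m eps0 maxS.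
  set a := approx_spectral_norm _ _ => am.
  have a0 : 0 < a.
    rewrite ltNge; apply/negP => a0; have : m * a <= 0 by rewrite mulr_ge0_le0.
    lra.
  apply: entropy_le; first by rewrite divr_gt0 // subr_gt0.
  by rewrite mulrAC ler_pdivlMr ?subr_gt0 // mul1r mulrC.
- rewrite /min_parity_certificate; case: ex_minnP => k cert _.
  rewrite -[k%:R]log2X; apply: entropy_le; first by rewrite exprn_gt0.
  exact: parity_certificate_ge cert maxS.
- rewrite /randomized_parity_complexity; case: ex_minnP => c /asboolP[mu muc muf] _.
  case: c muc => [mu0|c [_ depth_le]].
    have fcst := rpdt_complexity0_cst f mu mu0 muf.
    (* The bound 0 is read as [log2 1]: a constant [f] has a coefficient of absolute value 1 at the
       empty set. *)
    rewrite mulr0 -(mulr0 (2 * (1 + 1 / delta))).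
    have -> : 0 = log2 1 :> R by rewrite /log2 ln1 mul0r.
    apply: entropy_le => //; rewrite mul1r.
    apply: le_trans (maxS finset.set0).
    rewrite (_ : (fun x => _) = fun=> sign R (f [ffun=> false])); last first.
      by apply: funext => x; rewrite (fcst x [ffun=> false]).
    by rewrite fourier_cst eqxx mulr1 norm_sign.
  have [t mut agree] := rpdt_agreement mu f muf.
  have tm := pdt_agreement_ge f t m agree maxS.
  have : renyi_fourier_entropy (1 + delta) f
      <= 2 * (1 + 1 / delta) * log2 (3 * 2 ^+ c.+1).
    apply: entropy_le; first by rewrite mulr_gt0 // exprn_gt0.
    have : 2 ^+ pdt_depth t * m <= 2 ^+ c.+1 * m.
      by rewrite ler_wpM2r // ler_eXn2l ?ltr1n // depth_le.
    rewrite -mulrA; lra.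
  move=> le_H; apply: le_trans le_H _.
  rewrite [leRHS](_ : _ = 2 * (1 + 1 / delta) * ((1 + log2 3) * c.+1%:R)); last by ring.
  apply: ler_wpM2l => //.
  rewrite /log2 lnM ?posrE ?exprn_gt0 // mulrDl -!/(log2 _) log2X mulrDl mul1r addrC lerD2l.
  (* What remains is [log2 3 <= log2 3 * c.+1], which relies on the depth bound being at least 1. *)
  apply: ler_peMr; last by rewrite ler1n.
  by rewrite divr_ge0 ?ln_ge0 // ?ler1n.
Qed.
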